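(* Let $A\in\mathbb{R}^{m\times d}$, $b\in\mathbb{R}^m$, $c\in\mathbb{R}^d$, and let $P=\{x\in\mathbb{R}^d: Ax=b,\ x\ge 0\}$. Assume that $P$ is bounded and nonempty and that $c^\top x$ is not constant over $P$. Let $\Delta$, $R_1$, $R_H$ be the suboptimality gap, the $\ell_1$ radius and the entropic radius of $P$, and for $\eta>0$ let $x^\eta$ be the optimal solution of the entropy-penalized program. If $\eta \ge \frac{R_1+R_H}{\Delta}$, then $$c^\top x^\eta-\min_{x\in P}c^\top x\ \le\ \Delta\exp\Big(-\eta\frac{\Delta}{R_1}+\frac{R_1+R_H}{R_1}\Big).$$
   Context: For a nonnegative vector $x$, $H(x)=\sum_i x_i\log\frac1{x_i}$ (natural logarithm, with $0\log\frac10=0$; $x$ is not required to sum to $1$). For $\eta>0$, $x^\eta$ denotes the (unique) minimizer of $c^\top x-\eta^{-1}H(x)$ subject to $Ax=b$, where the entropy term implicitly enforces $x\ge 0$; i.e. the minimization is over $x\in P$. Let $V$ be the set of vertices of $P$ and $v^*\in\operatorname{argmin}_{v\in V}c^\top v$. The suboptimality gap is $\Delta=\min\{c^\top(v-v^* ): v\in V,\ c^\top v>c^\top v^*\}$. The $\ell_1$ radius is $R_1=\max_{x\in P}\|x\|_1$. The entropic radius is $R_H=\max_{x,y\in P}\big(H(x)-H(y)\big)$. *)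

(* Defs.v *)
From HB Require Import structures.
From mathcomp Require Import all_boot all_order all_algebra.
From mathcomp Require Import all_classical all_reals all_analysis.

Set Implicit Arguments.
Unset Strict Implicit.
Unset Printing Implicit Defensive.

Import Order.TTheory GRing.Theory Num.Theory.
Import numFieldNormedType.Exports.

Local Open Scope classical_set_scope.
Local Open Scope ring_scope.

(* Least and greatest element of a set of reals, and a minimizer of a function
   on a set: attained extrema, not mere infima or suprema. They take a junk
   value when the extremum does not exist. *)
Definition set_min (R : realType) (S : set R) : R :=
  xget 0 (S `&` lbound S).

Definition set_max (R : realType) (S : set R) : R :=
  xget 0 (S `&` ubound S).

Definition argmin (R : realType) (d : nat) (f : 'cV[R]_d -> R)
    (S : set 'cV[R]_d) : 'cV[R]_d :=
  xget 0 [set x | S x /\ forall y, S y -> f x <= f y].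

Definition dot (R : realType) (d : nat) (c x : 'cV[R]_d) : R :=
  \sum_(i < d) c i 0 * x i 0.

Definition polytope (R : realType) (m d : nat) (A : 'M[R]_(m, d))
    (b : 'cV[R]_m) : set 'cV[R]_d :=
  [set x | A *m x = b /\ forall i, 0 <= x i 0].

(* The vertices of a polyhedron are its extreme points. *)
Definition vertices (R : realType) (d : nat) (P : set 'cV[R]_d) :
    set 'cV[R]_d :=
  [set v | P v /\ forall (y z : 'cV[R]_d) (t : R), P y -> P z -> 0 < t < 1 ->
     v = t *: y + (1 - t) *: z -> y = z].

Definition l1norm (R : realType) (d : nat) (x : 'cV[R]_d) : R :=
  \sum_(i < d) `|x i 0|.

(* A zero coordinate contributes 0 because of the factor x i 0, whatever the
   value of ln 0^-1. *)
Definition entropy (R : realType) (d : nat) (x : 'cV[R]_d) : R :=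
  \sum_(i < d) x i 0 * ln (1 / x i 0).

Definition suboptimality_gap (R : realType) (d : nat) (c : 'cV[R]_d)
    (P : set 'cV[R]_d) : R :=
  let V := vertices P in
  let vstar := argmin (dot c) V in
  set_min [set dot c (v - vstar) | v in [set v | V v /\ dot c vstar < dot c v]].

Definition l1_radius (R : realType) (d : nat) (P : set 'cV[R]_d) : R :=
  set_max [set l1norm x | x in P].

Definition entropic_radius (R : realType) (d : nat) (P : set 'cV[R]_d) : R :=
  set_max [set entropy x - entropy y | x in P & y in P].

Definition penalized_opt (R : realType) (d : nat) (c : 'cV[R]_d)
    (P : set 'cV[R]_d) (eta : R) : 'cV[R]_d :=
  argmin (fun x => dot c x - eta^-1 * entropy x) P.

(* Main.v *)
(* Write x^eta = (1 - t) u + t w with u a minimizer of the linear cost and w in P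
   of suboptimality s >= Delta. Subadditivity of t ln(1/t) bounds
   H(x^eta) - H(u) by t (R_1 + R_H) + t ln(1/t) R_1, so optimality of x^eta
   against u gives eta s <= R_1 + R_H + ln(1/t) R_1, an exponential bound on the
   weight t. The suboptimality of x^eta is t s, and s exp(-eta s / R_1) is
   decreasing for s >= R_1 / eta, which covers s >= Delta. *)
Require Import Defs.
From HB Require Import structures.
From mathcomp Require Import all_boot all_order all_algebra.
From mathcomp Require Import all_classical all_reals all_analysis.
From mathcomp Require Import ring lra.
Set Implicit Arguments.
Unset Strict Implicit.
Unset Printing Implicit Defensive.
Import Order.TTheory GRing.Theory Num.Theory.
Import numFieldNormedType.Exports.
Local Open Scope classical_set_scope.
Local Open Scope ring_scope.

(** * Polytopes and their vertices *)

Lemma dotD (R : realType) (d : nat) (c x y : 'cV[R]_d) :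
  dot c (x + y) = dot c x + dot c y.
Proof. by rewrite /dot -big_split; apply: eq_bigr => i _; rewrite mxE mulrDr. Qed.

Lemma dotZ (R : realType) (d : nat) (c x : 'cV[R]_d) (a : R) :
  dot c (a *: x) = a * dot c x.
Proof. by rewrite /dot mulr_sumr; apply: eq_bigr => i _; rewrite mxE mulrCA. Qed.

Lemma dotB (R : realType) (d : nat) (c x y : 'cV[R]_d) :
  dot c (x - y) = dot c x - dot c y.
Proof. by rewrite dotD -scaleN1r dotZ mulN1r. Qed.

Definition convex_subset (R : realType) (d : nat) (K : set 'cV[R]_d) : Prop :=
  forall x y (t : R), K x -> K y -> 0 <= t <= 1 -> K (t *: x + (1 - t) *: y).

Lemma convex_polytope (R : realType) (m d : nat) (A : 'M[R]_(m, d)) b :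
  convex_subset (polytope A b).
Proof.
move=> x y t [Ax x0] [Ay y0] /andP[t0 t1]; split.
  by rewrite mulmxDr -!scalemxAr Ax Ay -scalerDl addrC subrK scale1r.
by move=> i; rewrite !mxE addr_ge0 // mulr_ge0 // subr_ge0.
Qed.

Lemma bounded_set_coord (R : realType) (d : nat) (P : set 'cV[R]_d) :
  bounded_set P -> exists M : R, forall x, P x -> forall i, x i 0 <= M.
Proof.
case=> M [_ HM]; exists (M + 1) => x Px i.
apply: le_trans (HM (M + 1) _ x Px); last by rewrite ltrDl.
apply: le_trans (ler_norm _) _.
rewrite [leRHS]mx_normrE.
by apply: (le_bigmax _ (fun ij => `|x ij.1 ij.2|) (i, 0)).
Qed.

(** A nonzero nonnegative direction in the kernel of [A] would span a ray from [x] that stays in the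
    polytope and is unbounded. *)
Lemma bounded_recession (R : realType) (m d : nat) (A : 'M[R]_(m, d)) b
    (x g : 'cV[R]_d) :
  bounded_set (polytope A b) -> polytope A b x -> A *m g = 0 -> g != 0 ->
  exists i, g i 0 < 0.
Proof.
move=> /bounded_set_coord[M HM] [Ax x0] Ag gN0; apply: contrapT => ng.
have g0 i : 0 <= g i 0 by rewrite leNgt; apply/negP => gi; apply: ng; exists i.
have [j gj] : exists j, 0 < g j 0.
  apply: contrapT => nj; case/eqP: gN0; apply/matrixP => i k.
  rewrite ord1 mxE; apply/eqP; rewrite eq_le g0 andbT leNgt.
  by apply/negP => gi; apply: nj; exists i.
have M0 : 0 <= M by apply: le_trans (x0 j) (HM x _ j); split.
(* A step of this length pushes coordinate [j] to at least [M + 1], past the bound [M]. *)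
pose s := (M + 1) / g j 0.
have s0 : 0 <= s by rewrite divr_ge0 ?addr_ge0.
have : polytope A b (x + s *: g).
  split; first by rewrite mulmxDr -scalemxAr Ag scaler0 addr0.
  by move=> i; rewrite !mxE; apply: addr_ge0; [exact: x0|exact: mulr_ge0 s0 (g0 i)].
move=> /HM/(_ j); rewrite !mxE divfK ?gt_eqF //.
by have := x0 j; lra.
Qed.

Definition coord_support (R : realType) (d : nat) (x : 'cV[R]_d) : {set 'I_d} :=
  finset (fun i => x i 0 != 0).

(* Moving from [x] along [g] until the first coordinate vanishes. *)
Lemma polytope_ray_exit (R : realType) (m d : nat) (A : 'M[R]_(m, d)) b
    (x g : 'cV[R]_d) :
  polytope A b x -> A *m g = 0 -> (forall i, x i 0 = 0 -> g i 0 = 0) ->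
  (exists i, g i 0 < 0) ->
  exists s : R, [/\ 0 < s, polytope A b (x + s *: g) &
    coord_support (x + s *: g) \proper coord_support x].
Proof.
move=> [Ax x0] Ag xg [i0 gi0].
(* Ratio test: among the decreasing coordinates, the one with the least ratio reaches zero first, so
   all others are still nonnegative then. *)
case: (@arg_minP _ _ _ i0 (fun i => g i 0 < 0) (fun i => x i 0 / - g i 0) gi0).
move=> i gi imin.
have xi : 0 < x i 0.
  rewrite lt_def x0 andbT; apply/negP => /eqP /xg gi'.
  by move: gi; rewrite gi' ltxx.
set s := x i 0 / - g i 0.
have s0 : 0 < s by rewrite divr_gt0 // oppr_gt0.
have sP : polytope A b (x + s *: g).
  split; first by rewrite mulmxDr -scalemxAr Ag scaler0 addr0.
  move=> j; rewrite !mxE; have [gj|gj] := ltP (g j 0) 0; last first.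
    by rewrite addr_ge0 // mulr_ge0 // ltW.
  have := imin _ gj; rewrite -/s ler_pdivlMr ?oppr_gt0 // mulrN; lra.
exists s; split=> //; apply/properP; split.
  apply/fintype.subsetP => j; rewrite !inE !mxE; apply: contra => /eqP xj.
  by rewrite xj (xg _ xj) mulr0 addr0.
exists i; first by rewrite inE gt_eqF.
by rewrite inE negbK !mxE /s; apply/eqP; field; rewrite lt_eqF.
Qed.

(** This is the statement that a bounded polytope is the convex hull of its vertices, phrased as an
    induction principle. Strong induction on the support size: a non-vertex lies on a segment
    between two points of the polytope with smaller support. *)
Lemma polytope_sub_convex (R : realType) (m d : nat) (A : 'M[R]_(m, d)) b
    (K : set 'cV[R]_d) :
  bounded_set (polytope A b) -> convex_subset K ->
  vertices (polytope A b) `<=` K -> polytope A b `<=` K.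
Proof.
move=> bP cK VK x.
have [n] := ubnP #|coord_support x|; elim: n => // n IH in x *.
rewrite ltnS => xn Px.
have [Vx|nVx] := pselect (vertices (polytope A b) x); first exact: VK.
have [y [z [t [Py Pz /andP[t0 t1] xE yz]]]] : exists y z (t : R),
    [/\ polytope A b y, polytope A b z, 0 < t < 1,
        x = t *: y + (1 - t) *: z & y <> z].
  apply: contrapT => nE; apply: nVx; split=> // y z t Py Pz t01 xE.
  by apply: contrapT => yz; apply: nE; exists y, z, t.
pose g := y - z.
have Ag : A *m g = 0 by rewrite mulmxBr Py.1 Pz.1 subrr.
have gN0 : g != 0 by rewrite subr_eq0; apply/eqP.
(* Both weights are positive and [y], [z] are nonnegative, so a zero coordinate of [x] is zero in
   both. *)
have xg i : x i 0 = 0 -> g i 0 = 0.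
  rewrite xE !mxE => /eqP; have y0 := Py.2 i; have z0 := Pz.2 i.
  have t1' : 0 < 1 - t by rewrite subr_gt0.
  rewrite paddr_eq0 ?mulr_ge0 ?(ltW t0) ?(ltW t1') // !mulf_eq0.
  by rewrite (gt_eqF t0) (gt_eqF t1') /= => /andP[/eqP-> /eqP->]; rewrite subrr.
have [r [r0 Pr rS]] := polytope_ray_exit Px Ag xg (bounded_recession bP Px Ag gN0).
have [|||s [s0 Ps sS]] := @polytope_ray_exit _ _ _ A b x (- g) Px.
- by rewrite mulmxN Ag oppr0.
- by move=> i /xg gi; rewrite mxE gi oppr0.
- by apply: (bounded_recession bP Px); rewrite ?mulmxN ?Ag ?oppr0 ?oppr_eq0.
have Kr := IH _ (leq_trans (proper_card rS) xn) Pr.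
have Ks := IH _ (leq_trans (proper_card sS) xn) Ps.
have rs : 0 < r + s by rewrite addr_gt0.
(* The weights are inversely proportional to the steps [r] and [s], so the displacements along [g]
   and [- g] cancel. *)
suff -> : x = (s / (r + s)) *: (x + r *: g) + (1 - s / (r + s)) *: (x + s *: - g).
  apply: cK => //; rewrite divr_ge0 ?(ltW s0) ?(ltW rs) //=.
  by rewrite ler_pdivrMr // mul1r lerDr ltW.
apply/matrixP => i j; rewrite !mxE; field; exact: lt0r_neq0.
Qed.

(** If [v] and [w] differed, equal supports would allow moving from [v] a little further away from
    [w]. Then [v] would lie strictly between [w] and another point of the polytope, against
    extremality. *)
Lemma vertices_support_inj (R : realType) (m d : nat) (A : 'M[R]_(m, d)) b
    (v w : 'cV[R]_d) :
  bounded_set (polytope A b) -> vertices (polytope A b) v -> polytope A b w ->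
  coord_support v = coord_support w -> v = w.
Proof.
move=> bP [Pv Vv] Pw vw; have [//|vNw] := eqVneq v w.
pose g := v - w.
have Ag : A *m g = 0 by rewrite mulmxBr Pv.1 Pw.1 subrr.
have gN0 : g != 0 by rewrite subr_eq0.
have vg i : v i 0 = 0 -> g i 0 = 0.
  move=> vi; move/setP/(_ i): vw; rewrite !inE !mxE vi eqxx.
  by move=> /esym/negbFE/eqP ->; rewrite subrr.
have [s [s0 Pz _]] := polytope_ray_exit Pv Ag vg (bounded_recession bP Pv Ag gN0).
have s1 : 0 < 1 + s by rewrite addr_gt0.
have wz : w = v + s *: g.
  apply: (Vv _ _ (s / (1 + s))) => //.
    by rewrite divr_gt0 //= ltr_pdivrMr // mul1r ltrDr.
  by apply/matrixP => i j; rewrite !mxE; field; exact: lt0r_neq0.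
have : (1 + s) *: g = 0.
  have sg : s *: g = w - v by rewrite [X in X - v]wz addrAC subrr add0r.
  by rewrite scalerDl scale1r sg addrC addrA subrK subrr.
by move/eqP; rewrite scaler_eq0 (negbTE gN0) gt_eqF.
Qed.

(** Vertices inject into the finitely many subsets of the coordinates through their supports. *)
Lemma finite_vertices (R : realType) (m d : nat) (A : 'M[R]_(m, d)) b :
  bounded_set (polytope A b) -> finite_set (vertices (polytope A b)).
Proof.
move=> bP.
have inj : {in vertices (polytope A b) &, injective (@coord_support R d)}.
  move=> v w /set_mem Vv /set_mem Vw; exact: vertices_support_inj bP Vv Vw.1.
apply: (card_le_finite (B := @coord_support R d @` vertices (polytope A b))) => //.
by move: (inj_card_eq inj); rewrite card_eq_le => /andP[].
Qed.

(** * Entropy *)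

Definition entropy_term (R : realType) (t : R) : R := t * ln (1 / t).

Lemma entropy_termE (R : realType) (t : R) :
  0 <= t -> entropy_term t = - (t * ln t).
Proof.
rewrite le_eqVlt /entropy_term => /predU1P[<-|t0]; first by rewrite !mul0r oppr0.
by rewrite div1r lnV ?posrE // mulrN.
Qed.

Lemma entropy_termM (R : realType) (a t : R) : 0 <= a -> 0 <= t ->
  entropy_term (a * t) = a * entropy_term t + t * entropy_term a.
Proof.
move=> a0 t0; rewrite !entropy_termE ?mulr_ge0 //.
move: a0; rewrite le_eqVlt => /predU1P[<-|a0]; first by rewrite !mul0r; ring.
move: t0; rewrite le_eqVlt => /predU1P[<-|t0]; first by rewrite mulr0 !mul0r; ring.
by rewrite lnM ?posrE //; ring.
Qed.

(** Monotonicity of [ln] gives [x * ln x <= x * ln (x + y)]; apply it to each summand. *)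
Lemma entropy_termD (R : realType) (s t : R) : 0 <= s -> 0 <= t ->
  entropy_term (s + t) <= entropy_term s + entropy_term t.
Proof.
move=> s0 t0; rewrite !entropy_termE ?addr_ge0 //.
rewrite -opprD lerN2 mulrDl.
suff H (x y : R) : 0 <= x -> 0 <= y -> x * ln x <= x * ln (x + y).
  by apply: lerD; [exact: H|rewrite addrC; exact: H].
rewrite le_eqVlt => /predU1P[<-|x0] y0; first by rewrite !mul0r.
by rewrite ler_pM2l // ler_ln ?posrE ?lerDl // ltr_wpDr.
Qed.

(** The tangent bound [ln t^-1 <= t^-1 - 1], multiplied by [t]. *)
Lemma entropy_term_le1B (R : realType) (t : R) : 0 <= t -> entropy_term t <= 1 - t.
Proof.
rewrite le_eqVlt => /predU1P[<-|t0]; first by rewrite /entropy_term mul0r subr0.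
rewrite /entropy_term div1r.
have := @le_ln1Dx R (t^-1 - 1); rewrite addrCA subrr addr0 => H.
have : ln t^-1 <= t^-1 - 1 by apply: H; rewrite ltrBrDr addNr invr_gt0.
by rewrite -(ler_pM2l t0) mulrBr mulfV ?gt_eqF // mulr1.
Qed.

Lemma entropy_term_ge0 (R : realType) (t : R) : 0 <= t <= 1 -> 0 <= entropy_term t.
Proof.
move=> /andP[t0 t1]; rewrite entropy_termE // -mulrN mulr_ge0 // oppr_ge0.
exact: ln_le0.
Qed.

(** In each coordinate, subadditivity separates the two summands and the product rule
    [entropy_termM] pulls out the weights. *)
Lemma entropy_mix (R : realType) (d : nat) (u w : 'cV[R]_d) (t : R) :
  (forall i, 0 <= u i 0) -> (forall i, 0 <= w i 0) -> 0 <= t <= 1 ->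
  entropy ((1 - t) *: u + t *: w) <=
    (1 - t) * entropy u + t * entropy w
    + entropy_term (1 - t) * l1norm u + entropy_term t * l1norm w.
Proof.
move=> u0 w0 /andP[t0 t1].
rewrite /entropy /l1norm !mulr_sumr -!big_split /=; apply: ler_sum => i _.
rewrite -!/(entropy_term _) !mxE !ger0_norm //.
have t1' : 0 <= 1 - t by rewrite subr_ge0.
apply: le_trans (entropy_termD _ _) _; rewrite ?mulr_ge0 //.
by rewrite !entropy_termM //; lra.
Qed.

(** Writing [x] as the square of its root [s], the product rule gives [2 * s * entropy_term s],
    whose last factor is at most 1. This controls continuity at zero. *)
Lemma entropy_term_sqrt (R : realType) (x : R) :
  0 < x < 1 -> `|entropy_term x| <= 2 * Num.sqrt x.
Proof.
move=> /andP[x0 x1]; rewrite ger0_norm; last first.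
  by rewrite entropy_term_ge0 ?(ltW x0) ?ltW.
have s0 : 0 < Num.sqrt x by rewrite sqrtr_gt0.
rewrite -{1}[x]sqr_sqrtr ?(ltW x0) // expr2 entropy_termM ?(ltW s0) //.
have := entropy_term_le1B (ltW s0).
nra.
Qed.

Lemma continuous_entropy_term (R : realType) : continuous (@entropy_term R).
Proof.
move=> x; have [x0|x0|->] := ltgtP x 0.
(* [ln] takes the value 0 at nonpositive arguments, so [entropy_term] vanishes identically on the
   negative axis. *)
- have xE : \near x, (fun=> 0 : R) x = entropy_term x.
    near=> y; rewrite /entropy_term ln0 ?mulr0 // div1r invr_le0 ltW //.
    by near: y; exact: lt_nbhsl.
  rewrite /continuous_at -[X in _ --> X](nbhs_singleton xE).
  by apply: cvg_trans (near_eq_cvg xE) _; exact: cvg_cst.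
- have xE : \near x, - (x * ln x) = entropy_term x.
    near=> y; rewrite entropy_termE // ltW //.
    by near: y; exact: lt_nbhsr.
  rewrite /continuous_at -[X in _ --> X](nbhs_singleton xE).
  apply: cvg_trans (near_eq_cvg xE) _.
  by apply: cvgN; apply: cvgM; [exact: cvg_id|exact: continuous_ln].
- rewrite /continuous_at {2}/entropy_term mul0r.
  apply/cvgr0Pnorm_lt => e e0.
  near=> y.
  have [y0|y0] := leP y 0.
    by rewrite /entropy_term ln0 ?mulr0 ?normr0 // div1r invr_le0.
  have y1 : y < 1 by near: y; apply: lt_nbhsl.
  apply: le_lt_trans (entropy_term_sqrt _) _; first by rewrite y0.
  (* The square-root bound falls below [e] as soon as [y < (e / 2) ^+ 2]. *)
  rewrite mulrC -ltr_pdivlMr // -[ltRHS]ger0_norm ?divr_ge0 ?(ltW e0) // -sqrtr_sqr.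
  rewrite ltr_sqrt ?exprn_gt0 ?divr_gt0 //.
  by near: y; apply: lt_nbhsl; rewrite ?exprn_gt0 ?divr_gt0.
Unshelve. all: by end_near. Qed.

Lemma continuous_sum_coord (R : realType) (d : nat) (f : 'I_d -> R -> R) :
  (forall i, continuous (f i)) ->
  continuous (fun x : 'cV[R]_d => \sum_i f i (x i 0)).
Proof.
move=> cf; apply: continuous_big => [z|i _ x].
  by apply: cvgD; [exact: cvg_fst|exact: cvg_snd].
apply: (continuous_comp (f := fun y : 'cV[R]_d => y i 0)); last exact: cf.
exact: coord_continuous.
Qed.

Lemma continuous_dot (R : realType) (d : nat) (c : 'cV[R]_d) : continuous (dot c).
Proof.
apply: (continuous_sum_coord (f := fun i t => c i 0 * t)) => i x.
by apply: cvgMl_tmp; exact: cvg_id.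
Qed.

Lemma continuous_l1norm (R : realType) (d : nat) : continuous (@l1norm R d).
Proof.
apply: (continuous_sum_coord (f := fun _ t => `|t|)) => i x.
exact: norm_continuous.
Qed.

Lemma continuous_entropy (R : realType) (d : nat) : continuous (@entropy R d).
Proof.
apply: (continuous_sum_coord (f := fun _ => @entropy_term R)) => i.
exact: continuous_entropy_term.
Qed.

Lemma continuous_trmx (T : topologicalType) (m n : nat) :
  continuous (fun x : 'M[T]_(m, n) => x^T).
Proof.
move=> x U [V xV VU]; exists (fun i j => V j i) => [i j|y yV].
  by have := xV j i; rewrite mxE.
by apply: VU => i j; rewrite mxE; exact: yV.
Qed.

Lemma closed_polytope (R : realType) (m d : nat) (A : 'M[R]_(m, d)) b :
  closed (polytope A b).
Proof.
have -> : polytope A b =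
    \bigcap_j (dot (row j A)^T @^-1` [set t | t = b j 0]) `&`
    \bigcap_i ((fun x : 'cV[R]_d => x i 0) @^-1` [set t | 0 <= t]).
  have dotE (x : 'cV[R]_d) j : dot (row j A)^T x = (A *m x) j 0.
    by rewrite mxE; apply: eq_bigr => i _; rewrite !mxE.
  apply/seteqP; split=> x [Ax x0]; split.
  - by move=> j _ /=; rewrite dotE Ax.
  - by move=> i _; exact: x0.
  - by apply/matrixP => i j; rewrite ord1 -dotE; exact: Ax.
  - by move=> i; exact: x0.
apply: closedI; apply: closed_bigI => j _; apply: preimage_closed.
- by move=> x _; exact: continuous_dot.
- exact: closed_eq.
- by move=> x _; exact: coord_continuous.
- exact: closed_ge.
Qed.

(** The polytope is a closed subset of the cube with side [[0, M]]. The cube is compact as a set of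
    row vectors, and transposition carries it to column vectors. *)
Lemma compact_polytope (R : realType) (m d : nat) (A : 'M[R]_(m, d)) b :
  bounded_set (polytope A b) -> compact (polytope A b).
Proof.
move=> /bounded_set_coord[M HM].
have box : compact [set x : 'rV[R]_d | forall i, `[0, M]%classic (x ord0 i)].
  by apply: (@rV_compact _ _ (fun=> `[0, M]%classic)) => _; exact: segment_compact.
apply: subclosed_compact (@closed_polytope _ _ _ A b) (continuous_compact _ box) _.
  exact: continuous_subspaceT (@continuous_trmx _ _ _).
move=> x Px; exists x^T; last exact: trmxK.
by move=> i /=; rewrite mxE in_itv /= Px.2 HM.
Qed.

(** * Attained extrema *)

Lemma set_minP (R : realType) (S : set R) :
  (exists x, S x /\ lbound S x) -> S (set_min S) /\ lbound S (set_min S).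
Proof. exact: xgetPex. Qed.

Lemma set_max_ub (R : realType) (S : set R) :
  (exists x, S x /\ ubound S x) -> ubound S (set_max S).
Proof. by move=> H; have [] := xgetPex 0 H. Qed.

(** The extreme value theorem supplies a minimizer, which rules out the default value of
    [argmin]. *)
Lemma compact_argmin (R : realType) (d : nat) (f : 'cV[R]_d -> R) S :
  S !=set0 -> compact S -> continuous f ->
  S (argmin f S) /\ forall y, S y -> f (argmin f S) <= f y.
Proof.
move=> S0 cS cf.
apply: (xgetPex 0 (P := [set x | S x /\ forall y, S y -> f x <= f y])).
have [x /set_mem Sx xmin] := compact_EVT_min S0 cS (continuous_subspaceT cf).
by exists x; split=> // y Sy; apply: xmin; rewrite inE.
Qed.

Lemma compact_max (R : realType) (d : nat) (f : 'cV[R]_d -> R) S :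
  S !=set0 -> compact S -> continuous f ->
  exists2 x, S x & forall y, S y -> f y <= f x.
Proof.
move=> S0 cS cf.
have [x /set_mem Sx xmax] := compact_EVT_max S0 cS (continuous_subspaceT cf).
by exists x => // y Sy; apply: xmax; rewrite inE.
Qed.

Lemma l1_radius_ge (R : realType) (d : nat) (P : set 'cV[R]_d) x :
  compact P -> P x -> l1norm x <= l1_radius P.
Proof.
move=> cP Px; have [|y Py ymax] := compact_max _ cP (@continuous_l1norm R d).
  by exists x.
apply: set_max_ub; last by exists x.
by exists (l1norm y); split; [exists y|move=> _ [z Pz <-]; exact: ymax].
Qed.

Lemma entropic_radius_ge (R : realType) (d : nat) (P : set 'cV[R]_d) x y :
  compact P -> P x -> P y -> entropy x - entropy y <= entropic_radius P.
Proof.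
move=> cP Px Py; have P0 : P !=set0 by exists x.
have [u Pu umax] := compact_max P0 cP (@continuous_entropy R d).
have [Pv vmin] := compact_argmin P0 cP (@continuous_entropy R d).
set v := argmin _ _ in Pv vmin.
apply: set_max_ub; last by exists x => //; exists y.
(* The largest difference is attained at a maximizer and a minimizer of the entropy, so [set_max] is
   a true maximum. *)
exists (entropy u - entropy v); split; first by exists u => //; exists v.
by move=> _ [z Pz [w Pw <-]]; rewrite lerB ?umax ?vmin.
Qed.

(** * The suboptimality gap *)

(** The unnormalized form of convexity also covers [a + b = 0], where any point of [K] serves;
    [convex_join] can then regroup weights that may vanish. *)
Lemma convex_scaled_sum (R : realType) (d : nat) (K : set 'cV[R]_d) x y (a b : R) :
  convex_subset K -> K x -> K y -> 0 <= a -> 0 <= b ->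
  exists2 z, K z & a *: x + b *: y = (a + b) *: z.
Proof.
move=> cK Kx Ky a0 b0; have [/eqP|ab] := eqVneq (a + b) 0.
  rewrite paddr_eq0 // => /andP[/eqP-> /eqP->].
  by exists x; rewrite // !scale0r !addr0 scale0r.
have ab0 : 0 < a + b by rewrite lt_def ab addr_ge0.
exists (a / (a + b) *: x + (1 - a / (a + b)) *: y).
  by apply: cK; rewrite // divr_ge0 //= ?(ltW ab0) // ler_pdivrMr // mul1r lerDl.
by apply/matrixP => i j; rewrite !mxE; field.
Qed.

(** Expand the mixture of two mixtures and collect the two terms from [U] into one point of [U], and
    likewise for [W]. *)
Lemma convex_join (R : realType) (d : nat) (U W : set 'cV[R]_d) :
  convex_subset U -> convex_subset W ->
  convex_subset [set x | exists u w (t : R),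
    [/\ U u, W w, 0 <= t <= 1 & x = (1 - t) *: u + t *: w]].
Proof.
move=> cU cW _ _ t [u [w [s [Uu Ww /andP[s0 s1] ->]]]]
  [u' [w' [s' [Uu' Ww' /andP[s0' s1'] ->]]]] /andP[t0 t1].
have [||p Up pE] :=
  convex_scaled_sum (a := t * (1 - s)) (b := (1 - t) * (1 - s')) cU Uu Uu'.
- by rewrite mulr_ge0 // subr_ge0.
- by rewrite mulr_ge0 // subr_ge0.
have [||q Wq qE] :=
  convex_scaled_sum (a := t * s) (b := (1 - t) * s') cW Ww Ww'.
- by rewrite mulr_ge0.
- by rewrite mulr_ge0 // subr_ge0.
exists p, q, (t * s + (1 - t) * s'); split=> //.
  by apply/andP; split; nra.
rewrite -qE.
have -> : 1 - (t * s + (1 - t) * s') = t * (1 - s) + (1 - t) * (1 - s') by ring.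
by rewrite -pE !scalerDr !scalerA addrACA.
Qed.

(** Without vertices, [polytope_sub_convex] would place the polytope inside the empty convex set. *)
Lemma vertices_nonempty (R : realType) (m d : nat) (A : 'M[R]_(m, d)) b :
  bounded_set (polytope A b) -> polytope A b !=set0 ->
  vertices (polytope A b) !=set0.
Proof.
move=> bP [x Px]; apply: contrapT => V0.
apply: (polytope_sub_convex bP (K := set0) _ _ Px); first by move=> ? ? ? [].
by move=> v Vv; apply: V0; exists v.
Qed.

Section Gap.
Variables (R : realType) (m d : nat) (A : 'M[R]_(m, d)) (b : 'cV[R]_m).
Variable c : 'cV[R]_d.
Let P := polytope A b.
Let V := vertices P.
Let Delta := suboptimality_gap c P.
Let cmin := set_min [set dot c x | x in P].
Let vstar := argmin (dot c) V.
Hypotheses (bP : bounded_set P) (P0 : P !=set0).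
Hypothesis cN : ~ (exists k : R, forall x, P x -> dot c x = k).

Let vstarP : V vstar /\ forall v, V v -> dot c vstar <= dot c v.
Proof.
apply: compact_argmin; last exact: continuous_dot.
  exact: vertices_nonempty.
by apply: finite_compact; exact: finite_vertices.
Qed.

Let le_vstar x : P x -> dot c vstar <= dot c x.
Proof.
apply: (polytope_sub_convex bP (K := [set x | dot c vstar <= dot c x])) => //.
  move=> y z t /= Ky Kz /andP[t0 t1]; rewrite dotD !dotZ; nra.
exact: vstarP.2.
Qed.

Let cminE : cmin = dot c vstar.
Proof.
have Pvs := vstarP.1.1.
have [|[x Px xE] cl] := @set_minP R [set dot c x | x in P].
  exists (dot c vstar); split; first by exists vstar.
  by move=> _ [x Px <-]; exact: le_vstar.
apply/eqP; rewrite eq_le; apply/andP; split; first by apply: cl; exists vstar.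
by rewrite /cmin -xE le_vstar.
Qed.

Let gapP :
  (exists v, [/\ V v, dot c vstar < dot c v &
     Delta = dot c v - dot c vstar]) /\
  forall v, V v -> dot c vstar < dot c v -> Delta <= dot c v - dot c vstar.
Proof.
pose S := [set v | V v /\ dot c vstar < dot c v].
have S0 : S !=set0.
  (* If every vertex were optimal, the vertices would lie in a level set of the cost, which is
     convex, and the cost would be constant on [P]. *)
  apply: contrapT => nS; apply: cN; exists (dot c vstar) => x Px.
  apply: (polytope_sub_convex bP (K := [set x | dot c x = dot c vstar]) _ _ Px).
    by move=> y z t /= yE zE _; rewrite dotD !dotZ yE zE -mulrDl addrC subrK mul1r.
  move=> v Vv /=; apply/eqP; rewrite eq_le (vstarP.2 _ Vv) andbT leNgt.
  by apply/negP => vlt; apply: nS; exists v.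
have fS : finite_set S.
  by apply: sub_finite_set (finite_vertices bP) => v [].
have [Sw wmin] := compact_argmin S0 (finite_compact fS) (@continuous_dot R d c).
set w := argmin _ _ in Sw wmin.
have [|[v Sv vE] vl] := @set_minP R [set dot c (v - vstar) | v in S].
  exists (dot c (w - vstar)); split; first by exists w.
  by move=> _ [v Sv <-]; rewrite !dotB lerB ?wmin.
split.
  by exists v; split; [exact: Sv.1|exact: Sv.2|rewrite -dotB; exact: esym vE].
by move=> u Vu ult; rewrite -dotB; apply: vl; exists u.
Qed.

Lemma suboptimality_gap_gt0 : 0 < suboptimality_gap c P.
Proof. by have [[v [_ vlt DE]] _] := gapP; rewrite -/Delta DE subr_gt0. Qed.

(* Every point is a mixture of a minimizer and a point of suboptimality at least
   [Delta]: the points of this form are a convex set containing the vertices. *)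
Lemma polytope_gap_mixture x : P x -> exists u w (t : R),
  [/\ P u /\ dot c u = set_min [set dot c x | x in P],
      P w /\ set_min [set dot c x | x in P] + suboptimality_gap c P <= dot c w,
      0 <= t <= 1 & x = (1 - t) *: u + t *: w].
Proof.
rewrite -/cmin -/Delta cminE.
pose U := [set u | P u /\ dot c u = dot c vstar].
pose W := [set w | P w /\ dot c vstar + Delta <= dot c w].
have [[w0 [Vw0 _ DE]] Dle] := gapP.
have Uv : U vstar by split; [exact: vstarP.1.1|].
have Ww : W w0 by split; [exact: Vw0.1|rewrite DE addrC subrK].
apply: (polytope_sub_convex bP (convex_join (U := U) (W := W) _ _)).
- move=> y z t [Py yE] [Pz zE] t01; split; first exact: convex_polytope.
  by rewrite dotD !dotZ yE zE -mulrDl addrC subrK mul1r.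
- move=> y z t [Py yE] [Pz zE] t01; split; first exact: convex_polytope.
  by case/andP: t01 => t0 t1; rewrite dotD !dotZ; nra.
(* An optimal vertex takes weight 0 on the filler point [w0]; any other vertex lies in [W] by
   definition of the gap and takes weight 1. *)
- move=> v Vv; have := vstarP.2 _ Vv; rewrite le_eqVlt => /predU1P[vE|vlt].
    exists v, w0, 0; split=> //; first by split; [exact: Vv.1|].
      by rewrite lexx ler01.
    by rewrite subr0 scale1r scale0r addr0.
  exists vstar, v, 1; split=> //; last by rewrite subrr scale0r scale1r add0r.
    by split; [exact: Vv.1|rewrite addrC -lerBrDr Dle].
  by rewrite lexx ler01.
Qed.

End Gap.

(** * The exponential bound *)

(** In [entropy_mix], the entropy difference of [w] and [u] enters with weight [t], and
    [entropy_term (1 - t) <= t] bounds the contribution of the norm of [u]. *)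
Lemma entropy_mixture_increase (R : realType) (d : nat) (P : set 'cV[R]_d)
    (u w : 'cV[R]_d) (t : R) :
  compact P -> (forall x, P x -> forall i, 0 <= x i 0) -> P u -> P w ->
  0 <= t <= 1 ->
  entropy ((1 - t) *: u + t *: w) - entropy u <=
    t * (l1_radius P + entropic_radius P) + entropy_term t * l1_radius P.
Proof.
move=> cP nnP Pu Pw /andP[t0 t1].
have t01 : 0 <= t <= 1 by rewrite t0.
have mix := entropy_mix (nnP _ Pu) (nnP _ Pw) t01.
have Hr := entropic_radius_ge cP Pw Pu.
have Ru := l1_radius_ge cP Pu; have Rw := l1_radius_ge cP Pw.
have u0 : 0 <= l1norm u by apply: sumr_ge0.
have R0 := le_trans u0 Ru.
have h1 : entropy_term (1 - t) * l1norm u <= t * l1_radius P.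
  apply: (@le_trans _ _ (t * l1norm u)); last exact: ler_wpM2l.
  apply: ler_wpM2r => //.
  by apply: le_trans (entropy_term_le1B _) _; rewrite ?subr_ge0 // subKr.
have h2 := ler_wpM2l (entropy_term_ge0 t01) Rw.
have h3 := ler_wpM2l t0 Hr.
lra.
Qed.

(** From [1 <= k * D], [expR (k * (s - D)) >= 1 + k * (s - D) >= 1 + (s - D) / D = s / D]. *)
Lemma mul_expR_decreasing (R : realType) (k D s : R) :
  0 < D -> 1 <= k * D -> D <= s -> s * expR (- (k * s)) <= D * expR (- (k * D)).
Proof.
move=> D0 kD Ds.
have -> : - (k * D) = k * (s - D) - k * s by ring.
rewrite expRD mulrA ler_wpM2r ?expR_ge0 // -ler_pdivrMl //.
apply: (@le_trans _ _ (1 + k * (s - D))); last exact: expR_ge1Dx.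
have -> : D^-1 * s = 1 + D^-1 * (s - D) by field; rewrite gt_eqF.
rewrite lerD2l ler_wpM2r ?subr_ge0 //.
by rewrite -(ler_pM2r D0) mulVf ?gt_eqF.
Qed.

Theorem theorem1 (R : realType) (m d : nat) (A : 'M[R]_(m, d)) (b : 'cV[R]_m)
    (c : 'cV[R]_d) (eta : R) :
  let P := polytope A b in
  let Delta := suboptimality_gap c P in
  let R1 := l1_radius P in
  let RH := entropic_radius P in
  bounded_set P ->
  P !=set0 ->
  ~ (exists k : R, forall x, P x -> dot c x = k) ->
  0 < eta ->
  (R1 + RH) / Delta <= eta ->
  dot c (penalized_opt c P eta) - set_min [set dot c x | x in P]
    <= Delta * expR (- (eta * (Delta / R1)) + (R1 + RH) / R1).
Proof.
move=> P Delta R1 RH bP P0 cN eta0 etaD.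
set cmin := set_min _.
have cP : compact P by exact: compact_polytope.
have D0 : 0 < Delta by exact: suboptimality_gap_gt0.
have nnP x : P x -> forall i, 0 <= x i 0 by case.
(* Otherwise the origin would be the only point of [P] and the cost would be constant. *)
have R10 : 0 < R1.
  rewrite ltNge; apply/negP => R1le; apply: cN; exists 0 => x Px.
  rewrite /dot big1 // => i _.
  suff -> : x i 0 = 0 by rewrite mulr0.
  apply/eqP; rewrite eq_le (nnP _ Px) andbT; apply: le_trans R1le.
  apply: le_trans (l1_radius_ge cP Px).
  apply: le_trans (ler_norm _) _.
  by rewrite /l1norm (bigD1 i) //= lerDl sumr_ge0.
have RH0 : 0 <= RH.
  by case: P0 => x Px; rewrite -(subrr (entropy x)); exact: entropic_radius_ge.
have [] := @compact_argmin R d (fun x => dot c x - eta^-1 * entropy x) P P0 cP.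
  move=> x; apply: (@continuousB _ _ _ (dot c) (fun x => eta^-1 * entropy x)).
    exact: continuous_dot.
  by apply: (@cvgMl_tmp R _ (nbhs x) _ (@entropy R d)); exact: continuous_entropy.
rewrite -/(penalized_opt c P eta); set x := penalized_opt _ _ _ => Px xmin.
have [u [w [t [[Pu uE] [Pw wE] /andP[t0 t1] xE]]]] :=
  polytope_gap_mixture bP P0 cN Px.
rewrite -/cmin -/Delta in uE wE.
set s := dot c w - cmin.
have Ds : Delta <= s by rewrite /s; lra.
have xs : dot c x - cmin = t * s by rewrite xE dotD !dotZ uE /s; ring.
rewrite xs.
(* At [t = 0] the point is already optimal; from here on [t] can be cancelled and its logarithm
   taken. *)
move: t0; rewrite le_eqVlt => /predU1P[<-|t0].
  by rewrite mul0r mulr_ge0 ?expR_ge0 // ltW.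
have t01 : 0 <= t <= 1 by rewrite ltW.
(* Optimality of [x] against [u], divided by [t]. *)
have key : eta * s <= R1 + RH - ln t * R1.
  have inc := entropy_mixture_increase cP nnP Pu Pw t01.
  rewrite -xE (entropy_termE (ltW t0)) -/R1 -/RH in inc.
  have opt : eta * dot c x - entropy x <= eta * cmin - entropy u.
    have := xmin _ Pu.
    by rewrite uE -(ler_pM2l eta0) !mulrBr !mulVKf ?gt_eqF.
  rewrite -(ler_pM2l t0).
  have : eta * (t * s) = eta * dot c x - eta * cmin by rewrite -xs mulrBr.
  lra.
(* Solve [key] for [ln t] and exponentiate. *)
have tle : t <= expR (- (eta * (s / R1)) + (R1 + RH) / R1).
  rewrite -[leLHS](lnK t0) ler_expR -(ler_pM2r R10).
  rewrite mulrDl mulNr -!mulrA mulVf ?gt_eqF // !mulr1; lra.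
apply: (@le_trans _ _ (s * expR (- (eta * (s / R1)) + (R1 + RH) / R1))).
  by rewrite mulrC ler_wpM2l // (le_trans (ltW D0)).
rewrite !expRD !mulrA ler_wpM2r ?expR_ge0 //.
(* Here the rate is [eta / R1]; its product with [Delta] is at least 1 because
   [eta * Delta >= R1 + RH >= R1]. *)
rewrite !(mulrAC _ _ R1^-1); apply: mul_expR_decreasing => //.
rewrite mulrAC ler_pdivlMr // mul1r.
by move: etaD; rewrite ler_pdivrMr //; apply: le_trans; rewrite lerDl.
Qed.
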